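(* Let $1<p<q$ be relatively prime integers. No word in $P(p,q)$ can be obtained through the satellite braid construction; that is, there are no Lorenz braids $A,B,C$ (or $A,C$, or $B,C$, when only one pattern braid is used) whose closures are knots, with the closure of $C$ a nontrivial knot and with $n_R(A)=n_L(B)$ when both patterns are used, such that the satellite braid built from them closes to a knot whose aperiodic word is, up to cyclic shift, a word in $P(p,q)$.
   Context: Words and Lorenz braids. Words are finite words in the letters $L<R$, ordered lexicographically; $n_L(w),n_R(w)$ are the numbers of $L$ and $R$ letters of $w$. A word is aperiodic if it is not of the form $v^j$ with $j>1$. The shift is $s(X_0X_1\cdots X_{n-1})=X_1\cdots X_{n-1}X_0$. An aperiodic word is $L$-maximal if it begins with $L$ and is the largest among its cyclic shifts beginning with $L$. An aperiodic word $w$ of length $n$ containing both letters determines a Lorenz braid on $n$ strings: order the $n$ shifts of $w$ lexicographically and label the positions $1,\dots,n$ accordingly; a string joins the startpoint at the position of $s^j(w)$ to the endpoint at the position of $s^{j+1}(w)$. The $L$ strings (those starting at words beginning with $L$) start at the $n_L(w)$ left positions and cross over $R$ strings (those starting at words beginning with $R$); each pair consisting of one $L$ and one $R$ string crosses at most once, and strings of the same type do not cross. The closure of this braid is a knot, the Lorenz knot corresponding to $w$, and every Lorenz braid closing to a knot arises in this way from a word unique up to cyclic shift. For a Lorenz braid $D$, $n_L(D)$, $n_R(D)$, $n(D)$ are its numbers of $L$ strings, $R$ strings and strings. The sets $P(p,q)$. For relatively prime $1<p<q$ write $q=kp+r$ with $k>0$, $0<r<p$. The torus knot $T(p,q)$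 is the closure of the Lorenz braid with $p$ $L$ strings and $q$ $R$ strings in which every $L$ string crosses over all $R$ strings; the standard word $w(p,q)$ is the $L$-maximal word of this braid (the evenly distributed word). It is a product of $p$ syllables: $r$ syllables $LR^{k+1}$ and $p-r$ syllables $LR^k$. $P(p,q)$ is the set of $L$-maximal words resulting from permuting the syllables of $w(p,q)$. Satellite braid construction. Take Lorenz braids $A$ (left pattern), $B$ (right pattern), $C$ (companion), each closing to a knot, with $n_R(A)=n_L(B)=k$ (here $k$ is the number just defined, unrelated to the quotient of $q$ by $p$). (1) Replace each string of $C$ by $k$ parallel strings. (2) Add $n_L(A)$ vertical strings on the left and $n_R(B)$ vertical strings on the right, obtaining a braid on $n=n_L(A)+n_R(B)+k\,n(C)$ strings. (3) Concatenate it with the $n$-braid consisting of $A$ on the first $n_L(A)+k$ positions, $B$ on the last $k+n_R(B)$ positions, and vertical strings in between. The result is a Lorenz braid (the satellite braid). The construction can also be carried out with only one pattern: if only $B$ is used, put $k=n_L(B)$, replace $A$ by the identity $k$-braid and set $n_L(A)=0$; if only $A$ is used, put $k=n_R(A)$, replace $B$ by the identity $k$-braid and set $n_R(B)=0$. *)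

(* Defs.v *)
From mathcomp Require Import all_boot all_order.

Set Implicit Arguments.
Unset Strict Implicit.
Unset Printing Implicit Defensive.

Definition L : bool := false.
Definition R : bool := true.

Definition word := seq bool.

Definition aperiodic (w : word) : Prop :=
  forall (v : word) (j : nat), 1 < j -> w <> flatten (nseq j v).

(* The iterated shift s^j(w) is [rot j w] (for j <= size w); [seqlexi bool]
   carries the lexicographic order of words, with false < true, i.e. L < R. *)
Definition word_lt (u v : word) : bool := ((u : seqlexi bool) < v)%O.
Definition word_le (u v : word) : bool := ((u : seqlexi bool) <= v)%O.

Definition Lmaximal (w : word) : Prop :=
  [/\ aperiodic w,
      ohead w = Some L
    & forall j, j < size w -> ohead (rot j w) = Some L -> word_le (rot j w) w].

(* Position (counted from 0) of s^j(w) among the shifts of w. *)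
Definition shift_pos (w : word) (j : nat) : nat :=
  count (fun i => word_lt (rot i w) (rot j w)) (iota 0 (size w)).

(* A positive braid on strings in positions 0, ..., n-1 is a sequence of
   crossings; the entry i stands for a crossing in which the string currently
   in position i passes over the string currently in position i+1. *)
Definition braid_word := seq nat.

Definition swap_at (s : seq nat) (i : nat) : seq nat :=
  [seq nth 0 s (if j == i then i.+1 else if j == i.+1 then i else j)
  | j <- iota 0 (size s)].

(* Strings are named by their startpoints; [arrangement n b] lists the strings
   by the position of their endpoints. *)
Definition arrangement (n : nat) (b : braid_word) : seq nat :=
  foldl swap_at (iota 0 n) b.

Definition endpoint (n : nat) (b : braid_word) (i : nat) : nat :=
  index i (arrangement n b).

(* The crossings, as pairs (over string, under string), of the braid [b] whose
   strings are initially arranged as [s]. *)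
Fixpoint crossings_from (s : seq nat) (b : braid_word) : seq (nat * nat) :=
  if b is i :: b' then
    (nth 0 s i, nth 0 s i.+1) :: crossings_from (swap_at s i) b'
  else [::].

Definition crossings (n : nat) (b : braid_word) : seq (nat * nat) :=
  crossings_from (iota 0 n) b.

Record split_braid := SplitBraid { nL : nat; nR : nat; braid : braid_word }.

Definition nstr (D : split_braid) : nat := nL D + nR D.

(* The L strings are those starting in positions 0, ..., nL - 1. *)
Definition lorenz_braid (D : split_braid) : Prop :=
  [/\ 0 < nL D /\ 0 < nR D,
      all (fun i => i.+1 < nstr D) (braid D),
      all (fun c => (c.1 < nL D) && (nL D <= c.2))
          (crossings (nstr D) (braid D))
    & uniq (crossings (nstr D) (braid D))].

(* The components of the closure are the cycles of the permutation. *)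
Definition closes_to_knot (D : split_braid) : Prop :=
  forall i, i < nstr D ->
    exists m, iter m (endpoint (nstr D) (braid D)) 0 = i.

Definition lorenz_knot_braid (D : split_braid) : Prop :=
  lorenz_braid D /\ closes_to_knot D.

Definition braid_has_word (D : split_braid) (w : word) : Prop :=
  [/\ aperiodic w,
      (L \in w) && (R \in w),
      nL D = count_mem L w,
      nR D = count_mem R w
    & forall j, j < size w ->
        endpoint (nstr D) (braid D) (shift_pos w j) = shift_pos w j.+1].

Definition torus_lorenz_braid (p q : nat) (D : split_braid) : Prop :=
  [/\ lorenz_braid D, nL D = p, nR D = q
    & forall i j, i < p -> p <= j < p + q ->
        (i, j) \in crossings (nstr D) (braid D)].

Definition standard_word (p q : nat) (u : word) : Prop :=
  Lmaximal u /\ exists D, torus_lorenz_braid p q D /\ braid_has_word D u.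

Definition syllable (m : nat) : word := L :: nseq m R.

(* A word beginning with L has exactly one decomposition into syllables, so
   that [s] below is the sequence of syllables of w(p,q). *)
Definition P (p q : nat) (w : word) : Prop :=
  Lmaximal w /\
  exists (u : word) (s t : seq nat),
    [/\ standard_word p q u,
        u = flatten (map syllable s),
        perm_eq s t
      & w = flatten (map syllable t)].

(* A crossing of string i over string i+1, each replaced by k parallel
   strings: positions k*i, ..., k*i + k - 1 pass over the k following ones,
   the rightmost of the overcrossing strings moving first. *)
Definition cable_crossing (k i : nat) : braid_word :=
  flatten [seq [seq k * i + (k.-1 - a) + b | b <- iota 0 k] | a <- iota 0 k].

Definition cable (k : nat) (b : braid_word) : braid_word :=
  flatten (map (cable_crossing k) b).

Definition translate (m : nat) (b : braid_word) : braid_word := map (addn m) b.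

(* [a] and [b] are the numbers of vertical strings added on the left and on the
   right; [bA] and [bB] are braids on a + k and k + b strings. The strings of
   the result that start at the left are the [a] added ones and the k-fold
   parallels of the L strings of [C]. *)
Definition satellite_gen (k a : nat) (bA : braid_word) (b : nat)
    (bB : braid_word) (C : split_braid) : split_braid :=
  SplitBraid (a + k * nL C) (b + k * nR C)
    (translate a (cable k (braid C)) ++ bA
       ++ translate (a + k * (nstr C).-1) bB).

(* Meaningful only when nR A = nL B. *)
Definition satellite (A B C : split_braid) : split_braid :=
  satellite_gen (nR A) (nL A) (braid A) (nR B) (braid B) C.

Definition satellite_left (A C : split_braid) : split_braid :=
  satellite_gen (nR A) (nL A) (braid A) 0 [::] C.

Definition satellite_right (B C : split_braid) : split_braid :=
  satellite_gen (nL B) 0 [::] (nR B) (braid B) C.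

(* An unoriented link diagram, placed so that the height function is generic,
   is read as a sequence of elementary pieces. A pair (t, i) means that the
   piece t is placed with i strands to its left: [Cup] opens two adjacent
   strands, [Cap] joins two adjacent strands, and [Cross s] crosses two
   adjacent strands, the strand entering on the left being the over one iff
   s = true. *)
Inductive tile := Cup | Cap | Cross of bool.

Definition diagram := seq (tile * nat).

Definition nin (t : tile) : nat := if t is Cup then 0 else 2.
Definition nout (t : tile) : nat := if t is Cap then 0 else 2.

Fixpoint width (n : nat) (d : diagram) : option nat :=
  if d is (t, i) :: d' then
    if i + nin t <= n then width (n - nin t + nout t) d' else None
  else Some n.

Definition link_diagram (d : diagram) : bool := width 0 d == Some 0.

(* The first five moves are the planar isotopies of diagrams in generic
   position, the others the Reidemeister moves; together they generate ambient
   isotopy of links (Freyd-Yetter, Turaev). *)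
Inductive move : diagram -> diagram -> Prop :=
| exchange f g i m :
    move [:: (g, i + nin f + m); (f, i)] [:: (f, i); (g, i + nout f + m)]
| zigzag_right i : move [:: (Cup, i); (Cap, i.+1)] [::]
| zigzag_left i : move [:: (Cup, i.+1); (Cap, i)] [::]
| pivot_cup s i :
    move [:: (Cup, i); (Cross s, i.+1)] [:: (Cup, i.+1); (Cross (~~ s), i)]
| pivot_cap s i :
    move [:: (Cross s, i); (Cap, i.+1)] [:: (Cross (~~ s), i.+1); (Cap, i)]
| reidemeister1_cup s i : move [:: (Cup, i); (Cross s, i)] [:: (Cup, i)]
| reidemeister1_cap s i : move [:: (Cross s, i); (Cap, i)] [:: (Cap, i)]
| reidemeister2 s i : move [:: (Cross s, i); (Cross (~~ s), i)] [::]
| reidemeister3 s i :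
    move [:: (Cross s, i); (Cross s, i.+1); (Cross s, i)]
         [:: (Cross s, i.+1); (Cross s, i); (Cross s, i.+1)].

Inductive isotopic : diagram -> diagram -> Prop :=
| isotopic_move d1 x y d2 :
    move x y -> link_diagram (d1 ++ x ++ d2) -> link_diagram (d1 ++ y ++ d2) ->
    isotopic (d1 ++ x ++ d2) (d1 ++ y ++ d2)
| isotopic_refl d : isotopic d d
| isotopic_sym d e : isotopic d e -> isotopic e d
| isotopic_trans d e f : isotopic d e -> isotopic e f -> isotopic d f.

Definition unknot : diagram := [:: (Cup, 0); (Cap, 0)].

(* Position i of the braid is joined to itself by the i-th of n nested arcs
   passing to the right of the braid. *)
Definition braid_closure (n : nat) (b : braid_word) : diagram :=
  [seq (Cup, i) | i <- iota 0 n] ++ [seq (Cross true, i) | i <- b]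
    ++ [seq (Cap, i) | i <- rev (iota 0 n)].

Definition nontrivial_closure (D : split_braid) : Prop :=
  ~ isotopic (braid_closure (nstr D) (braid D)) unknot.

Definition companion (C : split_braid) : Prop :=
  lorenz_knot_braid C /\ nontrivial_closure C.

Inductive satellite_braid : split_braid -> Prop :=
| satellite_both A B C :
    lorenz_knot_braid A -> lorenz_knot_braid B -> companion C ->
    nR A = nL B -> satellite_braid (satellite A B C)
| satellite_only_left A C :
    lorenz_knot_braid A -> companion C -> satellite_braid (satellite_left A C)
| satellite_only_right B C :
    lorenz_knot_braid B -> companion C -> satellite_braid (satellite_right B C).

(* Main.v *)
Require Import Defs.
From mathcomp Require Import all_boot all_order.
From mathcomp Require Import zify.

(** Let [f] be the map sending the startpoint of a string of a Lorenz braid to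
its endpoint. The word of the braid is the itinerary of [f]: the letters along
an orbit record on which side of the L/R split it lies, so the number of R's
after an L is the number of steps that [f] spends on the R side before it comes
back to the L positions ([gap_returns]). For the standard word [f] is the rotation by [q] of
the integers modulo [p + q], so these numbers are [K] or [K + 1] with
[K = q %/ p]; permuting syllables does not change that ([P_returns]). Hence a
satellite with a word in [P p q] would make, from every L position, [K] or
[K + 1] steps on the R side before returning, where [K > 0].

A left pattern [A] is impossible, since the first string of the satellite then
ends, as in [A], at an L position ([satellite_left_pattern]): it makes no step
on the R side.

With only a right pattern [B] on [m + b] strings, the map of the satellite
follows [m] copies of the map of [C], except on entering the last block of [m]
positions, where [B] acts ([right_endpoint_copy], [right_endpoint_extra]). In
a Lorenz knot the last L string ends at the last position ([lorenz_last]), so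
only the copies of the last L string [l] of [C] enter the last block, and the
last of these copies makes at least one extra R step inside [B]. If [C] has
another L string, the copies of its first one do not meet [B] before returning,
so it makes at least [K] steps on the R side, and so does [l] by monotonicity.
The extra step forces [l] to make exactly [K] of them, and by monotonicity
again so does every L string of [C]. The resulting return map of the L
positions is increasing, hence the identity, contrary to the connectedness of
the closure of [C] ([companion_one_L]).

So [C] has a single L string, its braid is the spiral with crossings
[0, 1, ..., n - 1] ([lorenz_one_L]), and its closure unwinds by first
Reidemeister moves ([spiral_closure_unknot]), contrary to the nontriviality of
the companion. *)

Set Implicit Arguments.
Unset Strict Implicit.
Unset Printing Implicit Defensive.

(** * The endpoint map of a braid *)

(** Where a string in position [x] goes at the crossing [i]. Following one
position at a time is easier than following the whole arrangement, because
cables and translates act on positions in a simple way. *)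
Definition step (x i : nat) : nat :=
  if x == i then i.+1 else if x == i.+1 then i else x.

Definition track (x : nat) (b : braid_word) : nat := foldl step x b.

Lemma stepK i : involutive (step^~ i).
Proof. move=> x; rewrite /step; do ! case: eqP; lia. Qed.

Lemma step_ltn n i x : i.+1 < n -> x < n -> step x i < n.
Proof. rewrite /step; do ! case: eqP; lia. Qed.

Lemma track_cat x b1 b2 : track x (b1 ++ b2) = track (track x b1) b2.
Proof. exact: foldl_cat. Qed.

Lemma track_inj b : injective (track^~ b).
Proof.
elim: b => //= i b IH x y /IH E.
by rewrite -(stepK i x) E stepK.
Qed.

Lemma track_ltn n b x : all (fun i => i.+1 < n) b -> x < n -> track x b < n.
Proof.
elim: b x => //= i b IH x /andP[hi hb] hx.
by apply: IH => //; apply: step_ltn.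
Qed.

Lemma track_lt_all n b x : all (fun i => n <= i) b -> x < n -> track x b = x.
Proof.
elim: b x => //= i b IH x /andP[hi hb] hx.
have ->: step x i = x by rewrite /step; do ! case: eqP; lia.
exact: IH.
Qed.

Lemma track_translate m b x : track (m + x) (translate m b) = m + track x b.
Proof.
elim: b x => //= i b IH x.
by rewrite -IH; congr foldl; rewrite /step; do ! case: eqP; lia.
Qed.

Lemma size_swap_at s i : size (swap_at s i) = size s.
Proof. by rewrite size_map size_iota. Qed.

Lemma nth_swap_at s i j :
  j < size s -> nth 0 (swap_at s i) j = nth 0 s (step j i).
Proof. by move=> hj; rewrite (nth_map 0) ?size_iota // nth_iota. Qed.

Lemma uniq_swap_at s i : i.+1 < size s -> uniq s -> uniq (swap_at s i).
Proof.
move=> hi hs; rewrite map_inj_in_uniq ?iota_uniq // => x y.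
rewrite !mem_iota /= => hx hy /eqP.
rewrite -/(step x i) -/(step y i) nth_uniq ?step_ltn // => /eqP E.
by rewrite -(stepK i x) E stepK.
Qed.

Lemma index_swap_at s i x : i.+1 < size s -> uniq s -> x \in s ->
  index x (swap_at s i) = step (index x s) i.
Proof.
move=> hi hs hx; have hk : index x s < size s by rewrite index_mem.
rewrite -[in LHS](nth_index 0 hx) -{1}(stepK i (index x s)) -nth_swap_at ?step_ltn //.
by rewrite index_uniq ?size_swap_at ?step_ltn // uniq_swap_at.
Qed.

Lemma mem_swap_at s i x : i.+1 < size s -> x \in s -> x \in swap_at s i.
Proof.
move=> hi hx; have hk : index x s < size s by rewrite index_mem.
rewrite -(nth_index 0 hx) -(stepK i (index x s)) -nth_swap_at ?step_ltn //.
by rewrite mem_nth // size_swap_at step_ltn.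
Qed.

Lemma index_foldl_swap_at s b x :
  all (fun i => i.+1 < size s) b -> uniq s -> x \in s ->
  index x (foldl swap_at s b) = track (index x s) b.
Proof.
elim: b s => //= i b IH s /andP[hi hb] hs hx.
by rewrite IH ?size_swap_at ?uniq_swap_at ?mem_swap_at // index_swap_at.
Qed.

Lemma index_iota0 n x : x < n -> index x (iota 0 n) = x.
Proof.
move=> hx; have E : nth 0 (iota 0 n) x = x by rewrite nth_iota.
by rewrite -{1}E index_uniq ?size_iota ?iota_uniq.
Qed.

(** An arrangement lists the strings by position, so [index] in it is the
inverse permutation, on which each crossing acts by [step]. *)
Lemma endpointE n b x :
  all (fun i => i.+1 < n) b -> x < n -> endpoint n b x = track x b.
Proof.
move=> hb hx; rewrite /endpoint index_foldl_swap_at ?size_iota ?iota_uniq ?mem_iota //.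
by rewrite index_iota0.
Qed.

(** Only a crossing of two strings can change their relative order. *)
Lemma not_crossing_ltn s b x y :
  all (fun i => i.+1 < size s) b -> uniq s -> x \in s -> y \in s ->
  (x, y) \notin crossings_from s b -> index x s < index y s ->
  track (index x s) b < track (index y s) b.
Proof.
elim: b s => //= i b IH s /andP[hi hb] hs hx hy.
rewrite inE negb_or => /andP[hne hnot] hlt.
rewrite -!index_swap_at //.
apply: IH; rewrite ?size_swap_at ?uniq_swap_at ?mem_swap_at ?index_swap_at //.
have : (index x s != i) || (index y s != i.+1).
  apply: contraNT hne; rewrite negb_or !negbK => /andP[/eqP <- /eqP <-].
  by rewrite !nth_index.
rewrite /step; do ! case: eqP; lia.
Qed.

(** After [x] has passed over [y], undoing the change of order would take a
crossing of [y] over [x]. *)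
Lemma crossing_ltn s b x y :
  all (fun i => i.+1 < size s) b -> uniq s -> x \in s -> y \in s ->
  (x, y) \in crossings_from s b -> (y, x) \notin crossings_from s b ->
  track (index y s) b < track (index x s) b.
Proof.
elim: b s => //= i b IH s /andP[hi hb] hs hx hy.
rewrite !inE negb_or => hin /andP[hne hnot].
rewrite -!index_swap_at //.
case/orP: hin => [/eqP[ex ey]|hin]; last first.
  by apply: IH; rewrite ?size_swap_at ?uniq_swap_at ?mem_swap_at.
apply: not_crossing_ltn; rewrite ?size_swap_at ?uniq_swap_at ?mem_swap_at //.
rewrite !index_swap_at // ex ey !index_uniq ?(ltnW hi) //.
rewrite /step; do ! case: eqP; lia.
Qed.

(** * Lorenz maps *)

(** What the endpoint map of a Lorenz braid on [n] strings, [l] of them L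
strings, retains of the braid; the analysis of satellites uses only this. *)
Record lorenz_map (l n : nat) (f : nat -> nat) : Prop := LorenzMap {
  lorenz_split : 0 < l < n;
  lorenz_bound : forall x, x < n -> f x < n;
  lorenz_inj : forall x y, x < n -> y < n -> f x = f y -> x = y;
  lorenz_mono : forall x y, x < y -> y < n -> (x < l) = (y < l) -> f x < f y
}.

Definition one_cycle (n : nat) (f : nat -> nat) : Prop :=
  forall i, i < n -> exists m, iter m f 0 = i.

Lemma lorenz_braid_map D : lorenz_braid D ->
  lorenz_map (nL D) (nstr D) (endpoint (nstr D) (braid D)).
Proof.
case=> [[hL hR] hb /allP hc _]; split.
- by rewrite /nstr; lia.
- by move=> x hx; rewrite endpointE // track_ltn.
- by move=> x y hx hy; rewrite !endpointE // => /track_inj.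
move=> x y hxy hy hxyL; have hx := ltn_trans hxy hy.
rewrite !endpointE // -(index_iota0 hx) -(index_iota0 hy).
apply: not_crossing_ltn; rewrite ?size_iota ?iota_uniq ?mem_iota ?index_iota0 //.
by apply/negP => /hc /=; rewrite hxyL; lia.
Qed.

Lemma full_crossing_ltn D i j : lorenz_braid D -> i < nL D -> nL D <= j < nstr D ->
  (i, j) \in crossings (nstr D) (braid D) ->
  endpoint (nstr D) (braid D) j < endpoint (nstr D) (braid D) i.
Proof.
case=> [_ hb /allP hc _] hi /andP[hj hjn] hin.
have hin' : i < nstr D by lia.
rewrite !endpointE // -(index_iota0 hin') -(index_iota0 hjn).
apply: crossing_ltn; rewrite ?size_iota ?iota_uniq ?mem_iota //.
by apply/negP => /hc /=; lia.
Qed.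

Lemma ltn_mono_gap a b f x y :
  (forall x y, a <= x -> x < y -> y < b -> f x < f y) ->
  a <= x -> x <= y -> y < b -> f x + (y - x) <= f y.
Proof.
move=> hf hx hxy; rewrite -(subnKC hxy) addKn.
elim: (y - x) => [|d IH] hb; first by rewrite !addn0.
have := hf (x + d) (x + d.+1) _ _ hb.
by have := IH _; lia.
Qed.

(** The two increasing halves are stacked in the opposite order, so they fill
their images without holes: the map is a rotation of the integers modulo
[n]. *)
Lemma full_lorenz_map l n f : lorenz_map l n f ->
  (forall i j, i < l -> l <= j < n -> f j < f i) ->
  (forall i, i < l -> f i = i + (n - l)) /\
  (forall j, l <= j < n -> f j = j - l).
Proof.
case=> /andP[hl hln] fb _ fm fc.
have gL x y : x <= y -> y < l -> f x + (y - x) <= f y.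
  by move=> hxy hy; apply: (@ltn_mono_gap 0 l) => // u v _ huv hv; apply: fm; lia.
have gR x y : l <= x -> x <= y -> y < n -> f x + (y - x) <= f y.
  by move=> hx hxy hy; apply: (@ltn_mono_gap l n) => // u v hu huv hv; apply: fm; lia.
have e0 : f 0 = n - l.
  have := gL 0 l.-1; have := fb l.-1; have := gR l n.-1.
  by have := fc 0 n.-1; lia.
split=> [i hi|j /andP[hj hjn]].
  have := gL 0 i; have := gL i l.-1; have := fb l.-1; lia.
by have := gR l j; have := gR j n.-1; have := fc 0 n.-1; lia.
Qed.

(** The last position comes from the last L or the last R string, the two
halves being increasing; in the second case it would be a fixed point. *)
Lemma lorenz_last l n f : lorenz_map l n f -> one_cycle n f -> f l.-1 = n.-1.
Proof.
case=> /andP[hl hln] fb fi fm fc.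
have fb' m : iter m f 0 < n by elim: m => [|m IH] /=; [lia | apply: fb].
have nofix : f n.-1 <> n.-1.
  move=> fix_last; have [|m] := fc n.-1; first lia.
  elim: m => [|m IH] /=; first lia.
  by move=> E; apply: IH; apply: fi => //; [lia | rewrite E fix_last].
have [|[|m] /= hm] := fc n.-1; [lia | lia |].
set x := iter m f 0 in hm; have hx : x < n by apply: fb'.
have [xl|lx] := ltnP x l.
  have [->//|ne] := eqVneq l.-1 x.
  by have := fm x l.-1; have := fb l.-1; lia.
case: nofix; have [E|ne] := eqVneq n.-1 x; first by rewrite {1}E.
by have := fm x n.-1; have := fb n.-1; lia.
Qed.

(** * Words and their shifts *)

Lemma count_ltn (T : eqType) (P Q : pred T) (s : seq T) x :
  subpred P Q -> x \in s -> Q x -> ~~ P x -> count P s < count Q s.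
Proof.
move=> PQ xs Qx nPx; have := count_predUI P [predI Q & predC P] s.
have -> : count (predU P [predI Q & predC P]) s = count Q s.
  apply: eq_count => y; rewrite /= /in_mem /=; have := PQ y.
  by case: (P y) => [->//|_]; rewrite andbT.
have -> : count (predI P [predI Q & predC P]) s = 0.
  by rewrite -(count_pred0 s); apply: eq_count => y; rewrite /= /in_mem /=; case: (P y); rewrite ?andbF.
have : 0 < count [predI Q & predC P] s; last lia.
by rewrite -has_count; apply/hasP; exists x => //; apply/andP.
Qed.

(** The least positive period of a word under rotation divides its length, so
the word is a power of its prefix of that length. *)
Lemma rot_fixed_repeat (w : word) d : 0 < d < size w -> rot d w = w ->
  exists (v : word) (j : nat), 1 < j /\ w = flatten (nseq j v).
Proof.
move=> hd hw.
have ex : exists i, (0 < i < size w) && (rot i w == w) by exists d; rewrite hd hw eqxx.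
case: (ex_minnP ex) => {hd hw ex} {}d /andP[/andP[d0 dn] /eqP hw] dmin.
have hmul e : d * e <= size w -> rot (d * e) w = w.
  elim: e => [|e IH] he; first by rewrite muln0 rot0.
  by rewrite mulnS rotD -?mulnS // IH //; lia.
have hdiv : size w = d * (size w %/ d).
  have E := divn_eq (size w) d; rewrite mulnC in E.
  have hr : size w %% d < d by rewrite ltn_mod.
  have hle : d * (size w %/ d) <= size w by lia.
  have hrot : rot (size w %% d) w = w.
    rewrite -{2}(hmul _ hle) -rotD; last by rewrite addnC -E.
    by rewrite addnC -E rot_size.
  have [r0|rpos] := posnP (size w %% d); first by lia.
  by have := dmin (size w %% d); rewrite hrot eqxx andbT; lia.
set e := size w %/ d in hdiv.
exists (take d w), e; split; first by case: (e) hdiv => [|[|?]] //=; lia.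
have htake k : k <= e -> take (d * k) w = flatten (nseq k (take d w)).
  elim: k => [|k IH] hk; first by rewrite muln0 take0.
  rewrite mulnS takeD /= -IH ?(ltnW hk) //; congr (_ ++ _).
  rewrite -{2}hw /rot takel_cat // size_drop hdiv.
  by have := leq_mul2l d k.+1 e; rewrite hk orbT mulnS; lia.
by rewrite -(htake e) // -hdiv take_size.
Qed.

Lemma aperiodic_rot_inj (w : word) i j : aperiodic w ->
  i < size w -> j < size w -> rot i w = rot j w -> i = j.
Proof.
move=> hw; wlog hij : i j / i <= j.
  move=> H hi hj E; case: (leqP i j) => [/H|/ltnW /H] -> //.
move=> hi hj; case: (ltngtP i j) hij => // hij _ E; exfalso.
have /rot_inj hrot : rot i (rot (j - i) w) = rot i w.
  by rewrite -rotD; rewrite subnKC ?E ?(ltnW hij) // ltnW.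
have [v [k [hk hv]]] : exists (v : word) k, 1 < k /\ w = flatten (nseq k v).
  by apply: rot_fixed_repeat hrot; lia.
exact: hw hk hv.
Qed.

Lemma nth_rot_modn (w : word) i s : i <= size w -> s < size w ->
  nth L (rot i w) s = nth L w ((i + s) %% size w).
Proof.
move=> hi hs; rewrite nth_cat size_drop nth_drop.
case: ltnP => h; first by rewrite modn_small //; lia.
rewrite nth_take; last lia.
have -> : i + s = s - (size w - i) + size w by lia.
by rewrite modnDr modn_small //; lia.
Qed.

Lemma word_lt_irr u : word_lt u u = false.
Proof. exact: Order.POrderTheory.ltxx. Qed.

Lemma word_lt_trans u v w : word_lt u v -> word_lt v w -> word_lt u w.
Proof. exact: Order.POrderTheory.lt_trans. Qed.

Lemma shift_pos_ltn w i j : i < size w -> word_lt (rot i w) (rot j w) ->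
  shift_pos w i < shift_pos w j.
Proof.
move=> hi hij; apply: (@count_ltn _ _ _ _ i) => //.
- by move=> k /word_lt_trans; apply.
- by rewrite mem_iota.
- by rewrite word_lt_irr.
Qed.

Lemma shift_pos_inj w i j : aperiodic w -> i < size w -> j < size w ->
  shift_pos w i = shift_pos w j -> i = j.
Proof.
move=> hw hi hj E; apply: (aperiodic_rot_inj hw) => //.
case: (Order.TotalTheory.ltgtP (rot i w : seqlexi bool) (rot j w)) => // h.
- by have := shift_pos_ltn hi h; rewrite E ltnn.
- by have := shift_pos_ltn hj h; rewrite E ltnn.
Qed.

Lemma shift_pos_lt_size w j : j < size w -> shift_pos w j < size w.
Proof.
move=> hj; rewrite -[X in _ < X](size_iota 0 (size w)) -(count_predT (iota _ _)).
by apply: (@count_ltn _ _ _ _ j); rewrite ?mem_iota ?word_lt_irr.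
Qed.

(** An aperiodic word visits every position of its braid, so statements about
all its L's are statements about all L positions. *)
Lemma shift_pos_surj w x : aperiodic w -> x < size w ->
  exists2 i, i < size w & shift_pos w i = x.
Proof.
move=> hw hx.
have [|||_ E] := @uniq_min_size _ (map (shift_pos w) (iota 0 (size w))) (iota 0 (size w)).
- rewrite map_inj_in_uniq ?iota_uniq // => i j.
  by rewrite !mem_iota => hi hj; apply: shift_pos_inj.
- by move=> y /mapP[i]; rewrite !mem_iota => hi ->; apply: shift_pos_lt_size.
- by rewrite size_map.
have : x \in iota 0 (size w) by rewrite mem_iota.
by rewrite -E => /mapP[i]; rewrite mem_iota => hi ->; exists i.
Qed.

Lemma rot_cons w i : i < size w -> exists v, rot i w = nth L w i :: v.
Proof. by move=> hi; rewrite /rot (drop_nth L hi); exists (drop i.+1 w ++ take i w). Qed.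

(** The shifts beginning with L precede the others, so the first letter of a
shift can be read off from its position. *)
Lemma leq_count_shift_pos w j : j < size w ->
  (count_mem L w <= shift_pos w j) = nth L w j.
Proof.
move=> hj.
have cL : count_mem L w = count (fun i => nth L w i == L) (iota 0 (size w)).
  by rewrite -[in LHS](mkseq_nth L w) /mkseq count_map.
have [vj ej] := rot_cons hj.
case hjR : (nth L w j).
  rewrite cL; apply/idP; rewrite /shift_pos -!size_filter.
  apply: uniq_leq_size; first by rewrite filter_uniq ?iota_uniq.
  move=> i; rewrite !mem_filter mem_iota => /andP[/eqP iL hi]; rewrite hi andbT.
  have [vi ei] := rot_cons hi.
  by rewrite ei ej iL hjR /word_lt Order.SeqLexiOrder.ltxi_cons.
apply/negbTE; rewrite -ltnNge cL /shift_pos.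
have -> : count (fun i => word_lt (rot i w) (rot j w)) (iota 0 (size w)) =
  count (fun i => word_lt (rot i w) (rot j w) && (nth L w i == L)) (iota 0 (size w)).
  apply: eq_in_count => i; rewrite mem_iota => hi /=.
  have [vi ei] := rot_cons hi.
  by rewrite ei ej hjR /word_lt Order.SeqLexiOrder.ltxi_cons; case: (nth L w i); rewrite ?andbT.
apply: (@count_ltn _ _ _ _ j) => [i /andP[] //|||] /=.
- by rewrite mem_iota.
- by rewrite hjR.
- by rewrite word_lt_irr.
Qed.

(** * Gaps of a word and return times of its braid *)

(** The second L makes the gap complete, instead of a lower bound. *)
Definition has_gap (x : nat) (u : word) : Prop :=
  exists v, u = L :: nseq x R ++ L :: v.

(** With a second syllable present, the L closing the gap lies within the
same rotation. *)
Lemma syllable_gap t x : 1 < size t -> x \in t ->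
  exists i, i < size (flatten (map syllable t)) /\
    has_gap x (rot i (flatten (map syllable t))).
Proof.
move=> ht hx; case/splitPr: hx ht => t1 t2.
rewrite size_cat /= map_cat flatten_cat /= => ht.
exists (size (flatten (map syllable t1))); split; first by rewrite size_cat /=; lia.
rewrite rot_size_cat /= -catA; rewrite /has_gap.
case: t2 ht => [|y t2] ht /=; last by eexists; congr (_ :: _ ++ _ :: _).
by case: t1 ht => [|y t1] /= ht; [lia | eexists; congr (_ :: _ ++ _ :: _)].
Qed.

(** An L occurs in a product of syllables only at the start of a syllable. *)
Lemma gap_syllable t k : 1 < size t -> k < size (flatten (map syllable t)) ->
  ohead (rot k (flatten (map syllable t))) = Some L ->
  exists2 x, x \in t & has_gap x (rot k (flatten (map syllable t))).
Proof.
move=> ht hk hhead.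
have [t1 [x [t2 [et ek]]]] : exists t1 x t2,
    t = t1 ++ x :: t2 /\ k = size (flatten (map syllable t1)).
  have hnth : nth L (flatten (map syllable t)) k = L.
    by move: hhead; rewrite /rot (drop_nth L hk) => -[].
  clear ht hhead; elim: t k hk hnth => //= x t IH k hk hnth.
  case: k hk hnth => [|k] /= hk hnth; first by exists [::], x, t.
  move: hnth; rewrite nth_cat size_nseq nth_nseq.
  case: ltnP => // hxk hnth.
  have [||t1 [y [t2 [-> ek]]]] := IH (k - x) => //.
    by move: hk; rewrite size_cat size_nseq; lia.
  exists (x :: t1), y, t2; split => //=.
  by rewrite size_cat size_nseq -ek; lia.
have := ht; rewrite ek et map_cat flatten_cat /= size_cat /= => ht'.
exists x; first by rewrite mem_cat inE eqxx orbT.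
rewrite rot_size_cat /= -catA /has_gap.
case: t2 et ht' => [|y t2] _ /= ht'; last by eexists; congr (_ :: _ ++ _ :: _).
by case: t1 ek ht' => [|y t1] _ /= ht'; [lia | eexists; congr (_ :: _ ++ _ :: _)].
Qed.

Lemma count_L_syllables t : count_mem L (flatten (map syllable t)) = size t.
Proof. by elim: t => //= x t IH; rewrite count_cat count_nseq IH. Qed.

(** Counted in steps outside the first [l] positions, so that the time of
return to the L positions is the length of a gap. *)
Definition returns (l : nat) (f : nat -> nat) (x z : nat) : Prop :=
  (forall s, 0 < s <= x -> l <= iter s f z) /\ iter x.+1 f z < l.

Section WordOrbit.
Variables (D : split_braid) (w : word).
Hypothesis hD : braid_has_word D w.
Let f := endpoint (nstr D) (braid D).

Lemma word_size : size w = nstr D.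
Proof.
case: hD => _ _ hl hr _; rewrite /nstr hl hr -(count_predC (pred1 L) w); congr addn.
by apply: eq_count => -[].
Qed.

Lemma iter_shift_pos i s : i < size w ->
  iter s f (shift_pos w i) = shift_pos w ((i + s) %% size w).
Proof.
case: hD => _ _ _ _ hf hi.
have hn : 0 < size w by lia.
elim: s => [|s IH]; first by rewrite addn0 modn_small.
rewrite iterS IH /f hf ?ltn_mod // addnS.
have -> : (i + s).+1 %% size w = ((i + s) %% size w).+1 %% size w.
  by rewrite -addn1 -modnDml addn1.
have : (i + s) %% size w < size w by rewrite ltn_mod.
rewrite leq_eqVlt => /orP[/eqP E|h]; last by rewrite [in RHS]modn_small.
by rewrite E modnn /shift_pos rot_size rot0.
Qed.

Lemma iter_letter i s : i < size w -> s < size w ->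
  (nL D <= iter s f (shift_pos w i)) = nth L (rot i w) s.
Proof.
case: hD => _ _ hl _ _ hi hs.
by rewrite iter_shift_pos // hl leq_count_shift_pos ?ltn_mod ?nth_rot_modn //; lia.
Qed.

Lemma gap_returns i x : i < size w -> has_gap x (rot i w) ->
  shift_pos w i < nL D /\ returns (nL D) f x (shift_pos w i).
Proof.
move=> hi [v ev]; have hs : size w = x.+2 + size v.
  by rewrite -(size_rot i) ev /= size_cat size_nseq /=; lia.
have h s : s < size w -> (nL D <= iter s f (shift_pos w i)) = nth L (rot i w) s.
  exact: iter_letter.
split; first by rewrite ltnNge (h 0) ?ev // hs.
split=> [s /andP[s0 sx]|].
  rewrite h; last lia.
  by case: s s0 sx => // s _ sx; rewrite ev /= nth_cat size_nseq sx nth_nseq sx.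
rewrite ltnNge h ?ev /=; last lia.
by rewrite nth_cat size_nseq ltnn subnn.
Qed.

End WordOrbit.

Lemma standard_word_size p q s : standard_word p q (flatten (map syllable s)) ->
  size s = p.
Proof.
by case=> _ [D [[_ <- _ _] [_ _ hL _ _]]]; rewrite hL count_L_syllables.
Qed.

(** Starting from [z < p], the rotation by [q] leads to [z + q], and each R
step then subtracts [p] until the position is again below [p]. *)
Lemma standard_word_gap p q s x : 1 < p ->
  standard_word p q (flatten (map syllable s)) -> x \in s ->
  (x == q %/ p) || (x == (q %/ p).+1).
Proof.
move=> hp hstd hx; have hsize := standard_word_size hstd.
case: hstd => _ [D [[hD eL eR hc] hu]].
have en : nstr D = p + q by rewrite /nstr eL eR.
have [fL fR] : (forall i, i < p -> endpoint (nstr D) (braid D) i = i + q) /\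
    (forall j, p <= j < p + q -> endpoint (nstr D) (braid D) j = j - p).
  have := @full_lorenz_map _ _ _ (lorenz_braid_map hD).
  rewrite en eL addKn; apply => i j hi hj.
  by rewrite -en; apply: full_crossing_ltn => //; [rewrite eL | rewrite eL en | apply: hc].
have [|i [hi hgap]] := @syllable_gap s x _ hx; first by rewrite hsize.
have [] := gap_returns hu hi hgap; rewrite eL.
set f := endpoint _ _ in fL fR *; set z := shift_pos _ i => hz [hge hlt].
have hdiv := divn_eq q p; have hmod : q %% p < p by rewrite ltn_mod; lia.
set k := q %/ p in hdiv *.
have hiter j : j <= x -> iter j.+1 f z + j * p = z + q.
  elim: j => [|j IH] hj; first by rewrite /= fL // addn0.
  have hjx := ltnW hj; have := hge j.+1 hj; move: (IH hjx).
  rewrite iterS => /= E hp'; rewrite fR; last lia.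
  by rewrite mulSn; lia.
have [hxk|hkx] := ltnP x k.
  have := hiter x (leqnn x); have : x.+1 * p <= k * p by rewrite leq_mul2r hxk orbT.
  by rewrite mulSn; lia.
have [|hkx'] := leqP x k.+1; first lia.
have := hge k.+2; have := hiter k.+1 (ltnW hkx'); rewrite mulSn; lia.
Qed.

(** * The endpoint map of a satellite braid *)

(** Consecutive crossings carry one string over the next [k] ones. *)
Lemma track_iota x s k : track x (iota s k) =
  if x == s then s + k else if s < x <= s + k then x.-1 else x.
Proof.
elim: k s x => [|k IH] s x /=; first by case: eqP => ?; repeat (case: ifP => ?); lia.
rewrite IH /step; case: (x =P s) => ?; last case: (x =P s.+1) => ?; repeat (case: eqP => ?); repeat (case: ifP => ?); lia.
Qed.

(** Each row of a cabled crossing carries one more of the [k] over strings,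
beginning with the rightmost, past the [k] under strings. *)
Lemma track_cable_rows k i n x : n <= k ->
  track x (flatten [seq [seq k * i + (k.-1 - a) + b | b <- iota 0 k] | a <- iota 0 n]) =
  if k * i + k - n <= x < k * i + k then x + k
  else if k * i + k <= x < k * i + k + k then x - n else x.
Proof.
elim: n => [|n IH] hn; first by rewrite /= subn0; repeat (case: ifP => ?); lia.
rewrite -addn1 iotaD map_cat flatten_cat track_cat IH ?(ltnW hn) //= cats0 add0n.
rewrite -iotaDl addn0 track_iota.
case: (boolP (k * i + k - n <= x < k * i + k)) => ?;
  last case: (boolP (k * i + k <= x < k * i + k + k)) => ?; repeat (case: eqP => ?); repeat (case: ifP => ?); lia.
Qed.

Lemma track_cable_crossing k i y t : t < k ->
  track (k * y + t) (cable_crossing k i) = k * step y i + t.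
Proof.
move=> ht; rewrite /cable_crossing track_cable_rows // /step.
have [->|ne] := eqVneq y i; first by rewrite mulnS; repeat (case: ifP => ?); lia.
have [->|ne'] := eqVneq y i.+1; first by rewrite mulnS; repeat (case: ifP => ?); lia.
have [hlt|hlt] := ltnP y i.
  have : k * y.+1 <= k * i by rewrite leq_mul2l hlt orbT.
  by rewrite mulnS; repeat (case: ifP => ?); lia.
have : k * i.+2 <= k * y by rewrite leq_mul2l; lia.
by rewrite !mulnS; repeat (case: ifP => ?); lia.
Qed.

Lemma track_cable k b y t : t < k -> track (k * y + t) (cable k b) = k * track y b + t.
Proof.
move=> ht; elim: b y => //= i b IH y.
by rewrite /cable /= track_cat track_cable_crossing // -/(cable k b) IH.
Qed.

Lemma all_cable k b n : all (fun i => i.+1 < n) b ->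
  all (fun i => i.+1 < k * n) (cable k b).
Proof.
elim: b => //= i b IH /andP[hi /IH hb].
rewrite /cable /= all_cat -/(cable k b) hb andbT.
apply/allP => x /flattenP[r /mapP[a]]; rewrite mem_iota => ha -> /mapP[c].
rewrite mem_iota => hc ->.
have : k * i.+2 <= k * n by rewrite leq_mul2l hi orbT.
by rewrite !mulnS; lia.
Qed.

Lemma all_translate m b n n' : m + n <= n' -> all (fun i => i.+1 < n) b ->
  all (fun i => i.+1 < n') (translate m b).
Proof.
move=> hmn /allP hb; apply/allP => x /mapP[i /hb hi ->]; lia.
Qed.

Lemma satellite_endpoint k a bA b bB C T x : 0 < nstr C ->
  all (fun i => i.+1 < nstr C) (braid C) ->
  all (fun i => i.+1 < a + k) bA -> all (fun i => i.+1 < k + b) bB ->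
  T = satellite_gen k a bA b bB C ->
  x < nstr T -> endpoint (nstr T) (braid T) x = track x (braid T).
Proof.
move=> hN hC hA hB eT hx; apply: endpointE hx.
have eN : nstr T = a + k * nstr C + b by rewrite eT /nstr /= mulnDr; lia.
rewrite eN eT !all_cat; apply/and3P; split.
- by apply: all_translate (all_cable k hC); lia.
- apply/allP => i /(allP hA).
  have : k * 1 <= k * nstr C by rewrite leq_mul2l hN orbT.
  lia.
- apply: all_translate hB.
  by rewrite -[in X in _ <= X](prednK hN) mulnS; lia.
Qed.

(** The first string avoids the cable of [C]; the pattern [A] keeps it among
the first [nL A + nR A] positions, all of them L positions because [C] has an
L string. *)
Lemma satellite_left_pattern A C b bB T :
  lorenz_braid A -> lorenz_braid C -> all (fun i => i.+1 < nR A + b) bB ->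
  T = satellite_gen (nR A) (nL A) (braid A) b bB C ->
  endpoint (nstr T) (braid T) 0 < nL T.
Proof.
case=> [[hAL hAR] hA _ _] [[hCL hCR] hC _ _] hB eT.
have hN : 1 < nstr C by rewrite /nstr; lia.
have hk n : 0 < n -> nR A <= nR A * n.
  by move=> hn; rewrite -{1}(muln1 (nR A)) leq_mul2l hn orbT.
rewrite (satellite_endpoint (ltnW hN) hC hA hB eT); last by rewrite eT /nstr /=; lia.
have E0 : track 0 (translate (nL A) (cable (nR A) (braid C))) = 0.
  by apply: (@track_lt_all (nL A)) => //; apply/allP => i /mapP[j _ ->]; lia.
have hA0 : track 0 (braid A) < nL A + nR A by apply: track_ltn => //; lia.
rewrite eT /= !track_cat E0 (@track_lt_all (nL A + nR A)) //.
- by have := hk _ hCL; lia.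
- by apply/allP => i /mapP[j _ ->]; have := hk (nstr C).-1; lia.
Qed.

Section RightPattern.
Variables B C : split_braid.
Hypotheses (hB : lorenz_braid B) (hC : lorenz_braid C).
Let T := satellite_right B C.
Let m := nL B.
Let N := nstr C.
Let fB := endpoint (nstr B) (braid B).
Let fC := endpoint (nstr C) (braid C).
Let fT := endpoint (nstr T) (braid T).

Lemma right_endpoint x : x < nstr T -> fT x = track x (braid T).
Proof.
case: hB hC => [_ hBr _ _] [[hl hr] hCr _ _].
by apply: satellite_endpoint hCr _ hBr erefl => //; rewrite /nstr; lia.
Qed.

Lemma nstr_right : nstr T = m * N + nR B.
Proof. by rewrite /nstr /= mulnDr; lia. Qed.

Lemma right_endpoint_copy y t : y < N -> t < m ->
  fT (m * y + t) = if fC y == N.-1 then m * N.-1 + fB t else m * fC y + t.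
Proof.
case: hB hC => [_ hBr _ _] [[hl hr] hCr _ _] hy ht.
have hyN : m * y.+1 <= m * N by rewrite leq_mul2l hy orbT.
rewrite right_endpoint; last by rewrite nstr_right; move: hyN; rewrite mulnS; lia.
rewrite /= track_cat -[m * y + t]/(0 + (m * y + t)) track_translate track_cable //.
rewrite !add0n -/m -/N /fC endpointE // -/N.
have hty : track y (braid C) < N by apply: track_ltn.
case: eqP => [->|ne].
  by rewrite track_translate /fB endpointE //; rewrite /nstr -/m; lia.
apply: (@track_lt_all (m * N.-1)).
  by apply/allP => i /mapP[j _ ->]; lia.
have : m * (track y (braid C)).+1 <= m * N.-1 by rewrite leq_mul2l; lia.
by rewrite mulnS; lia.
Qed.

Lemma right_endpoint_extra u : u < nR B -> fT (m * N + u) = m * N.-1 + fB (m + u).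
Proof.
case: hB hC => [_ hBr _ _] [[hl hr] hCr _ _] hu.
have hN : 0 < N by rewrite /N /nstr; lia.
rewrite right_endpoint; last by rewrite nstr_right; lia.
rewrite /= track_cat -/m -/N.
have -> : track (m * N + u) (translate 0 (cable m (braid C))) = m * N + u.
  rewrite -[m * N + u]/(0 + (m * N + u)) track_translate; congr addn.
  have hr' := all_cable m hCr.
  elim: (cable _ _) hr' => //= i s IH /andP[hi /IH hs].
  have -> : step (m * N + u) i = m * N + u; last exact: hs.
  by move: hi; rewrite -/N /step; do ! case: eqP; lia.
have -> : m * N + u = m * N.-1 + (m + u) by rewrite -{1}(prednK hN) mulnS; lia.
by rewrite track_translate /fB endpointE //; rewrite /nstr -/m; lia.
Qed.

End RightPattern.

(** * The companion of a right pattern *)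

(** [c] and [m] are the numbers of L strings of the companion and of the right
pattern, [N] and [m + b] their numbers of strings. If [c] were larger than 1,
comparing the first and the last L string of the companion would show that all
of them have the same return time, which a single cycle excludes. *)
Lemma companion_one_L c N m b K fC fB fT :
  lorenz_map c N fC -> one_cycle N fC ->
  lorenz_map m (m + b) fB -> one_cycle (m + b) fB ->
  (forall y t, y < N -> t < m ->
    fT (m * y + t) = if fC y == N.-1 then m * N.-1 + fB t else m * fC y + t) ->
  (forall u, u < b -> fT (m * N + u) = m * N.-1 + fB (m + u)) ->
  0 < K ->
  (forall z, z < m * c ->
    exists2 x, (x == K) || (x == K.+1) & returns (m * c) fT x z) ->
  c = 1.
Proof.
move=> lC cC lB cB hcopy hextra hK hret.
have lastC := lorenz_last lC cC; have lastB := lorenz_last lB cB.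
case: lC => /andP[c0 cN] bC iC mC; case: lB => /andP[m0 b0] bB _ _.
have [->//|c1] := eqVneq c 1; exfalso.
have hc1 : 1 < c by lia.
have bCi i y : y < N -> iter i fC y < N by move=> hy; elim: i => //= i; apply: bC.
have bBi i y : y < m + b -> iter i fB y < m + b by move=> hy; elim: i => //= i; apply: bB.
have notlast y : y < N -> y != c.-1 -> fC y == N.-1 = false.
  move=> hy ne; apply/negP => /eqP; rewrite -lastC => /iC E.
  by move/eqP: ne; apply; apply: E; lia.
have gem y : c <= y -> m * c <= m * y by rewrite leq_mul2l orbC => ->.
(* The first L string is not the last, so neither it nor its R positions lead
   into the last block: its copy follows it exactly until it returns. *)
have shadow0 i : i <= K ->
    iter i fT 0 = m * iter i fC 0 /\ (0 < i -> c <= iter i fC 0).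
  elim: i => [|i IH] hi; first by rewrite muln0.
  have [E hci] := IH (ltnW hi).
  have hE : iter i.+1 fT 0 = m * iter i.+1 fC 0.
    have yN : iter i fC 0 < N by apply: bCi; lia.
    have yne : iter i fC 0 != c.-1.
      by case: i hci {IH E hi yN} => [|i] /= hci; [lia | have := hci isT; lia].
    by rewrite /= E -[m * iter i fC 0]addn0 hcopy ?notlast ?addn0.
  split=> // _.
  have [|x hx [hge _]] := hret 0; first by rewrite muln_gt0 m0.
  have := hge i.+1; rewrite hE leq_pmul2l //; apply.
  by case/orP: hx => /eqP ->; lia.
(* The other L strings of the companion lie to the right of the first one, hence
   stay on the R side, where the order is kept, for as long. *)
have monoC i x y : i <= K.+1 -> x < y -> y < c -> iter i fC x < iter i fC y.
  elim: i x y => //= i IH x y hi hxy hyc.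
  apply: mC; [by apply: IH => //; lia | by apply: bCi; lia |].
  case: (posnP i) => [->/=|i0]; first lia.
  have ge z : z < c -> c <= iter i fC z.
    have [_ /(_ i0) h0] := shadow0 i hi.
    move=> hz; case: (posnP z) => [->//|z0].
    by apply: leq_trans h0 (ltnW _); apply: IH => //; lia.
  by have := ge x; have := ge y; lia.
have geC i y : 0 < i <= K -> y < c -> c <= iter i fC y.
  case/andP=> i0 iK hy; have [_ /(_ i0) h0] := shadow0 i iK.
  case: (posnP y) => [->//|y0].
  by have := @monoC i 0 y (leqW iK) y0 hy; lia.
(* The rightmost copy of the last L string, the one sent to the very last
   position of the satellite. *)
set z := m * c.-1 + m.-1.
have hz : z < m * c by rewrite /z -{2}(prednK c0) mulnS; lia.
have [x hx [hge hlt]] := hret z hz.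
have cN1 : m * c <= m * N.-1 by apply: gem; lia.
have shadowB i : (forall j, 0 < j <= i -> m <= iter j fB m.-1) ->
    iter i.+1 fT z = m * N.-1 + iter i.+1 fB m.-1.
  elim: i => [|i IH] hj.
    by rewrite /= hcopy ?lastC ?eqxx //; lia.
  rewrite iterS IH; last by move=> j hij; apply: hj; lia.
  have hi : m <= iter i.+1 fB m.-1 by apply: hj; lia.
  have hi' : iter i.+1 fB m.-1 < m + b by apply: bBi; lia.
  have -> : m * N.-1 + iter i.+1 fB m.-1 = m * N + (iter i.+1 fB m.-1 - m).
    have -> : m * N = m * N.-1 + m by rewrite -{1}(prednK (ltn_trans c0 cN)) mulnS addnC.
    by lia.
  by rewrite hextra ?subnKC //; lia.
(* As long as the orbit of [m - 1] in the pattern avoids the L positions of the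
   pattern, that of [z] stays on the R side, and it must return. *)
have exB : exists i, (0 < i) && (iter i fB m.-1 < m).
  have [/existsP[i /andP[i0 hi]]|] := boolP [exists i : 'I_x.+2, (0 < i) && (iter i fB m.-1 < m)].
    by exists i; rewrite i0.
  rewrite negb_exists => /forallP hall; exfalso.
  have hall' j : 0 < j <= x.+1 -> m <= iter j fB m.-1.
    move=> /andP[j0 hj]; have := hall (Ordinal (hj : j < x.+2)).
    by rewrite /= j0 /= -leqNgt.
  have := shadowB x; move: hlt; have : m <= iter x.+1 fB m.-1 by apply: hall'; lia.
  move=> _ hlt /(_ _) E; have : iter x.+1 fT z = m * N.-1 + iter x.+1 fB m.-1.
    by apply: E => j hj; apply: hall'; lia.
  by lia.
case: (ex_minnP exB) => {exB} e1 /andP[e10 ht] emin.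
have e11 : e1 <> 1 by move=> E; move: ht; rewrite E /= lastB; lia.
have [e ee] : exists e, e1 = e.+1 by exists e1.-1; lia.
rewrite {e1}ee in e10 ht emin e11.
have inB j : 0 < j <= e -> m <= iter j fB m.-1.
  move=> /andP[j0 hj]; rewrite leqNgt; apply/negP => hlt'.
  by have := emin j; rewrite j0 hlt' /=; lia.
have shadowB' i : i <= e -> iter i.+1 fT z = m * N.-1 + iter i.+1 fB m.-1.
  by move=> hi; apply: shadowB => j hj; apply: inB; lia.
have shadowC i : i <= K ->
    iter (i + e.+1) fT z = m * iter i.+1 fC c.-1 + iter e.+1 fB m.-1.
  elim: i => [|i IH] hi; first by rewrite add0n shadowB' //= lastC.
  have hci : c <= iter i.+1 fC c.-1 by apply: geC; lia.
  have hcN : iter i.+1 fC c.-1 < N by apply: bCi; lia.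
  rewrite addSn iterS IH ?(ltnW hi) // hcopy // notlast //.
  by apply/eqP; lia.
have hR j : 0 < j <= e + K -> m * c <= iter j fT z.
  move=> /andP[j0 hj]; case: (leqP j e.+1) => hje.
    by have := shadowB' j.-1; rewrite prednK //; lia.
  have -> : j = (j - e.+1) + e.+1 by lia.
  rewrite shadowC; last lia.
  apply: leq_trans (leq_addr _ _); apply: gem; apply: geC; lia.
(* Now [e] extra steps inside the pattern and at least [K] steps following the
   companion fit into at most [K + 1] steps. *)
have hxe : e + K <= x.
  by rewrite leqNgt; apply/negP => hxe; have := hR x.+1; lia.
have [xE eE] : x = K.+1 /\ e = 1 by case/orP: hx => /eqP hx; lia.
have hlast : iter K.+1 fC c.-1 < c.
  have := shadowC K (leqnn K); have -> : K + e.+1 = x.+1 by lia.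
  move=> E; move: hlt; rewrite E => hlt'.
  by rewrite -(ltn_pmul2l m0); lia.
(* An increasing map of the [c] L positions into themselves fixes 0. *)
have fix0 : iter K.+1 fC 0 = 0.
  have := @ltn_mono_gap 0 c (iter K.+1 fC) 0 c.-1 _ isT (leq0n _).
  have hmono : forall u v, 0 <= u -> u < v -> v < c -> iter K.+1 fC u < iter K.+1 fC v.
    by move=> u v _; apply: monoC.
  by move=> /(_ hmono); lia.
have [n hn] := cC 1 (ltn_trans hc1 cN).
have hper j : iter (j * K.+1) fC 0 = 0.
  by elim: j => // j IH; rewrite mulSn iterD IH fix0.
move: hn; rewrite (divn_eq n K.+1) addnC iterD hper.
case: (posnP (n %% K.+1)) => [->//|r0].
have hr : 0 < n %% K.+1 <= K by rewrite r0 -ltnS ltn_mod.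
by have := geC _ 0 hr c0; lia.
Qed.

(** All crossings have the single L string on top, so each crossing must sit
where the previous one left that string. *)
Lemma lorenz_one_L C : lorenz_knot_braid C -> nL C = 1 -> braid C = iota 0 (nR C).
Proof.
case=> [[[_ hR] hb hc hu] hk] hL.
have lC : lorenz_braid C by split => //; rewrite hL.
have E : nstr C = (nR C).+1 by rewrite /nstr hL.
have gen s b : all (fun i => i.+1 < size s) b -> uniq s -> 0 \in s ->
    all (fun c => c.1 < 1) (crossings_from s b) -> b = iota (index 0 s) (size b).
  elim: b s => //= i b IH s /andP[hi hb'] hs h0 /andP[/= hi0 hall].
  have ei : index 0 s = i.
    have /eqP <- : nth 0 s i == 0 by lia.
    by rewrite index_uniq // ltnW.
  rewrite ei; congr (_ :: _).
  rewrite {1}(IH (swap_at s i)) ?size_swap_at ?uniq_swap_at ?mem_swap_at //.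
  by rewrite index_swap_at // ei /step eqxx.
have eb : braid C = iota (index 0 (iota 0 (nstr C))) (size (braid C)).
  apply: gen; rewrite ?size_iota ?iota_uniq ?mem_iota //; first by rewrite E.
  by apply: sub_all hc => c /andP[]; rewrite hL.
rewrite index_iota0 ?E // in eb.
have := lorenz_last (lorenz_braid_map lC) hk.
rewrite hL endpointE // E // eb track_iota eqxx add0n => es.
by move: es => /= <-.
Qed.

(** * The closure of a braid with one L string *)

Lemma width_cat n d1 d2 : width n (d1 ++ d2) = obind (width^~ d2) (width n d1).
Proof. by elim: d1 n => //= -[t i] d1 IH n; case: ifP. Qed.

(** Read from left to right, no move asks for a strand that was not already
there, so rewriting in this direction always leads from diagrams to diagrams;
for the zigzags the converse fails. *)
Lemma width_move x y n k : move x y -> width n x = Some k -> width n y = Some k.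
Proof.
case=> /=.
- move=> f g i m0; case: ifP => // h1; case: ifP => // h2 [<-].
  case: ifP => [h3|]; last lia.
  case: ifP => [h4|]; last lia.
  by congr Some; lia.
all: intros; match goal with H : (if _ then _ else _) = Some _ |- _ => move: H end.
all: repeat (case: ifP => //= ?); try (move=> [<-]); try (congr Some); lia.
Qed.

Lemma isotopic_reduce d1 x y d2 : move x y -> link_diagram (d1 ++ x ++ d2) ->
  isotopic (d1 ++ x ++ d2) (d1 ++ y ++ d2) /\ link_diagram (d1 ++ y ++ d2).
Proof.
move=> hxy hx.
have hy : link_diagram (d1 ++ y ++ d2).
  move: hx; rewrite /link_diagram !width_cat.
  case: (width 0 d1) => //= n; rewrite !width_cat.
  by case hn : (width n x) => [k|] //=; rewrite (width_move hxy hn).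
by split=> //; apply: isotopic_move.
Qed.

Definition crosses (s : seq nat) : diagram := [seq (Cross true, i) | i <- s].

(** The cup opens to the right of all these crossings, so it can wait. *)
Lemma cup_past_crosses d1 s j d2 : all (fun i => i.+2 <= j) s ->
  link_diagram (d1 ++ ((Cup, j) :: crosses s) ++ d2) ->
  isotopic (d1 ++ ((Cup, j) :: crosses s) ++ d2)
           (d1 ++ rcons (crosses s) (Cup, j) ++ d2) /\
  link_diagram (d1 ++ rcons (crosses s) (Cup, j) ++ d2).
Proof.
elim: s d1 => [|i s IH] d1 /=; first by move=> _ h; split=> //; apply: isotopic_refl.
case/andP=> hi hs h.
have hm : move [:: (Cup, j); (Cross true, i)] [:: (Cross true, i); (Cup, j)].
  by have := exchange (Cross true) Cup i (j - i.+2); rewrite /= addn2 subnKC.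
have [iso1 h1] := isotopic_reduce (d1 := d1) (d2 := crosses s ++ d2) hm h.
have := IH (rcons d1 (Cross true, i)) hs; rewrite !cat_rcons /= => /(_ h1)[iso2 h2].
by split=> //; apply: isotopic_trans iso1 iso2.
Qed.

(** Between its cup and its cap, the innermost closing arc meets only the last
crossing, which is a kink. The first Reidemeister move is applied in its cup
form, after the crossing has been turned around the cap; the remaining zigzag
is then straightened. *)
Lemma spiral_closure_step j : link_diagram (braid_closure j.+2 (iota 0 j.+1)) ->
  isotopic (braid_closure j.+2 (iota 0 j.+1)) (braid_closure j.+1 (iota 0 j)) /\
  link_diagram (braid_closure j.+1 (iota 0 j)).
Proof.
set cups := [seq (Cup, i) | i <- iota 0 j.+1].
set caps := [seq (Cap, i) | i <- rev (iota 0 j.+1)].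
have E : braid_closure j.+2 (iota 0 j.+1) =
    cups ++ ((Cup, j.+1) :: crosses (iota 0 j)) ++ (Cross true, j) :: (Cap, j.+1) :: caps.
  rewrite /braid_closure -[j.+2]addn1 (iotaD 0 j.+1 1) rev_cat !map_cat -/cups -/caps.
  have -> : iota 0 j.+1 = iota 0 j ++ [:: j] by rewrite -addn1 iotaD.
  by rewrite map_cat -!catA.
have E' : braid_closure j.+1 (iota 0 j) = cups ++ crosses (iota 0 j) ++ caps by [].
rewrite E => h0.
have [|iso1] := cup_past_crosses _ h0.
  by apply/allP => i; rewrite mem_iota; lia.
rewrite -cats1 -!catA /= => h1.
have := @isotopic_reduce (cups ++ crosses (iota 0 j) ++ [:: (Cup, j.+1)]) _ _ caps (pivot_cap true j).
rewrite -!catA /= => /(_ h1)[iso2 h2].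
have := @isotopic_reduce (cups ++ crosses (iota 0 j)) _ _ ((Cap, j) :: caps)
  (reidemeister1_cup false j.+1).
rewrite -!catA /= => /(_ h2)[iso3 h3].
have := @isotopic_reduce (cups ++ crosses (iota 0 j)) _ _ caps (zigzag_left j).
rewrite -!catA /= => /(_ h3)[iso4 h4].
rewrite E'; split=> //.
apply: isotopic_trans iso4; apply: isotopic_trans iso3; apply: isotopic_trans iso2.
by rewrite -cats1 -!catA in iso1.
Qed.

Lemma width_cups m n i : i <= n -> width n [seq (Cup, k) | k <- iota i m] = Some (n + m.*2).
Proof.
elim: m n i => [|m IH] n i hi /=; first by rewrite addn0.
rewrite addn0 hi IH; last lia.
by congr Some; lia.
Qed.

Lemma width_crosses n s : all (fun i => i.+2 <= n) s -> width n (crosses s) = Some n.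
Proof.
elim: s => //= i s IH /andP[hi hs]; rewrite addn2 hi subnK ?IH //; lia.
Qed.

Lemma width_caps m : width m.*2 [seq (Cap, k) | k <- rev (iota 0 m)] = Some 0.
Proof.
elim: m => // m IH; rewrite -addn1 iotaD rev_cat map_cat /= add0n.
case: ifP => [_|]; last lia.
by rewrite -IH; congr width; lia.
Qed.

Lemma link_diagram_closure n b :
  all (fun i => i.+1 < n) b -> link_diagram (braid_closure n b).
Proof.
move=> /allP hb; rewrite /link_diagram /braid_closure !width_cat width_cups //= add0n.
rewrite width_cat width_crosses /= ?width_caps //.
by apply/allP => i /hb; lia.
Qed.

Lemma spiral_closure_unknot j : isotopic (braid_closure j.+1 (iota 0 j)) unknot.
Proof.
elim: j => [|j IH]; first exact: isotopic_refl.
apply: isotopic_trans IH; apply: (proj1 (spiral_closure_step _)).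
by apply: link_diagram_closure; apply/allP => i; rewrite mem_iota; lia.
Qed.

(** * Words with permuted syllables *)

Lemma rot_rot_lt (w : word) i j : i < size w ->
  exists2 k, k < size w & rot i (rot j w) = rot k w.
Proof.
move=> hi.
have red k : exists2 k', k' < size w & rot k w = rot k' w.
  case: (ltnP k (size w)) => h; first by exists k.
  by exists 0; [lia | rewrite rot_oversize // rot0].
have [j' hj' ->] := red j.
by rewrite rot_add_mod ?(ltnW hi) ?(ltnW hj').
Qed.

(** Permuting syllables permutes the gaps, and rotating the word only moves the
starting point on the orbit. *)
Lemma P_returns p q w D j z : 1 < p -> P p q w ->
  braid_has_word D (rot j w) -> z < nL D ->
  exists2 x, (x == q %/ p) || (x == (q %/ p).+1) &
    returns (nL D) (endpoint (nstr D) (braid D)) x z.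
Proof.
move=> hp [_ [u [s [t [hu es hst ew]]]]] hD hz.
rewrite es in hu.
have hsize : size t = p by rewrite -(perm_size hst) (standard_word_size hu).
have ht : 1 < size t by rewrite hsize.
have [ap _ hl _ _] := hD.
have hn : z < size (rot j w).
  by rewrite (word_size hD) /nstr; lia.
have [i hi ei] := shift_pos_surj ap hn.
have hi' : i < size w by rewrite -(size_rot j).
have [k hk ek] := rot_rot_lt j hi'.
have hhead : ohead (rot k w) = Some L.
  rewrite -ek; have [v ->] := rot_cons hi; rewrite /= -(leq_count_shift_pos hi) ei -hl.
  by rewrite leqNgt hz.
rewrite ew in hk hhead ek.
have [x hx hgap] := gap_syllable ht hk hhead.
exists x.
  by apply: standard_word_gap hp hu _; rewrite (perm_mem hst).
rewrite -ek -ew in hgap.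
by have [_] := gap_returns hD hi hgap; rewrite ei.
Qed.

Theorem theorem1 (p q : nat) (hp : 1 < p) (hpq : p < q) (hcop : coprime p q)
    (w : word) (hw : P p q w) :
  ~ exists (D : split_braid) (j : nat),
      satellite_braid D /\ braid_has_word D (rot j w).
Proof.
move=> [D [j [hsat hD]]].
have hret := fun z => P_returns (z := z) hp hw hD.
have K0 : 0 < q %/ p by rewrite divn_gt0 //; lia.
(* Two consecutive L's would be a gap of length 0. *)
have noLL : nL D <= endpoint (nstr D) (braid D) 0.
  have nL0 : 0 < nL D.
    by case: hD => _ /andP[hL _] -> _ _; rewrite -has_count has_pred1.
  have [x hx [hge _]] := hret 0 nL0.
  by have := hge 1; apply; case/orP: hx => /eqP ->.
case: hsat hD hret noLL => [A B C|A C|B C].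
- move=> [hA _] [[_ hB _ _] _] [[hC _] _] hAB _ _; rewrite leqNgt => /negP; apply.
  by apply: (satellite_left_pattern hA hC _ (erefl _)); rewrite hAB.
- move=> [hA _] [[hC _] _] _ _; rewrite leqNgt => /negP; apply.
  exact: (satellite_left_pattern (b := 0) hA hC _ (erefl _)).
move=> [hB cB] [[hC cC] hnontriv] _ hret _; apply: hnontriv.
have one : nL C = 1.
  apply: (companion_one_L (lorenz_braid_map hC) cC (lorenz_braid_map hB) cB
    (right_endpoint_copy hB hC) (right_endpoint_extra hB hC) K0).
  by rewrite -[nL B * nL C]/(nL (satellite_right B C)).
rewrite (lorenz_one_L (conj hC cC) one) /nstr one add1n.
exact: spiral_closure_unknot.
Qed.
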